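(* For all integers $n\geq 0$, $$a_{1^{1}3^{1}4^{-3}}(4n)>0,\qquad a_{1^{1}3^{1}4^{-3}}(4n+2)<0,\qquad a_{1^{1}3^{1}4^{-3}}(2n+1)<0.$$
   Context: For $|q|<1$ (or as formal power series in $q$) let $f_j:=(q^j;q^j)_\infty=\prod_{k\ge 1}(1-q^{jk})$ for each positive integer $j$. The integers $a_{1^{1}3^{1}4^{-3}}(n)$, $n\ge 0$, are defined by $\sum_{n=0}^\infty a_{1^{1}3^{1}4^{-3}}(n)q^n=\dfrac{f_1f_3}{f_4^3}$. *)

(* Defs.v *)
From mathcomp Require Import all_boot all_order all_algebra.
Set Implicit Arguments.
Unset Strict Implicit.
Unset Printing Implicit Defensive.
Import Order.TTheory GRing.Theory Num.Theory.
Local Open Scope ring_scope.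

(* A formal power series over the integers is its sequence of coefficients. *)
Definition fps := nat -> int.

Definition fps1 : fps := fun n => (n == 0%N)%:R.

Definition fps_mul (f g : fps) : fps :=
  fun n => \sum_(i < n.+1) f i * g (n - i)%N.

Definition fps_exp (f : fps) (m : nat) : fps := iter m (fps_mul f) fps1.

(* The first n.+1 coefficients of 1 / f, obtained by solving f * g = 1
   degree by degree; meaningful when f 0 is a unit (see fps_mulfV). *)
Fixpoint fps_inv_seq (f : fps) (n : nat) : seq int :=
  if n is m.+1 then
    let s := fps_inv_seq f m in
    rcons s (- (f 0%N)^-1 * \sum_(i < m.+1) f (m.+1 - i)%N * s`_i)
  else [:: (f 0%N)^-1].

Definition fps_inv (f : fps) : fps := fun n => (fps_inv_seq f n)`_n.

Definition fps_div (f g : fps) : fps := fps_mul f (fps_inv g).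

Definition qpoch_part (j N : nat) : {poly int} :=
  \prod_(1 <= k < N.+1) (1 - 'X^(j * k)).

(* f_j = (q^j; q^j)_oo for j > 0: the n-th coefficient of the infinite product
   is that of any partial product with at least n factors (see qpochE). *)
Definition qpoch (j : nat) : fps := fun n => (qpoch_part j n)`_n.

Definition a_1_3_m4 : fps :=
  fps_div (fps_mul (qpoch 1) (qpoch 3)) (fps_exp (qpoch 4) 3).

Lemma qpochE (j n N : nat) :
  (0 < j)%N -> (n <= N)%N -> (qpoch_part j N)`_n = qpoch j n.
Proof.
move=> j_gt0; elim: N => [|N IHN]; first by rewrite leqn0 => /eqP ->.
rewrite leq_eqVlt => /orP[/eqP -> //|]; rewrite ltnS => le_nN.
rewrite -IHN // /qpoch_part [in LHS]big_nat_recr //= mulrBr mulr1 coefB coefMXn.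
by rewrite (leq_trans _ (leq_pmull _ j_gt0)) ?ltnS // subr0.
Qed.

Lemma size_fps_inv_seq (f : fps) (n : nat) : size (fps_inv_seq f n) = n.+1.
Proof. by elim: n => //= n IHn; rewrite size_rcons IHn. Qed.

Lemma nth_fps_inv_seq (f : fps) (n i : nat) :
  (i <= n)%N -> (fps_inv_seq f n)`_i = fps_inv f i.
Proof.
elim: n => [|n IHn]; first by rewrite leqn0 => /eqP ->.
rewrite leq_eqVlt => /orP[/eqP -> //|le_in].
by rewrite /= nth_rcons size_fps_inv_seq le_in IHn.
Qed.

Lemma fps_mulfV (f : fps) :
  f 0%N \is a GRing.unit -> fps_mul f (fps_inv f) =1 fps1.
Proof.
move=> uf [|n]; first by rewrite /fps_mul big_ord1 /= mulrV.
rewrite /fps_mul big_ord_recl /= subn0 {1}/fps_inv /= nth_rcons.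
rewrite size_fps_inv_seq ltnn eqxx mulNr mulrN mulrA mulrV // mul1r.
apply/eqP; rewrite addrC subr_eq0; apply/eqP.
rewrite (reindex_inj rev_ord_inj) /=; apply: eq_bigr => i _.
have le_in : (i <= n)%N by rewrite -ltnS.
have -> : bump 0 (n.+1 - i.+1) = (n.+1 - i)%N by rewrite subSS subSn.
by rewrite nth_fps_inv_seq // subKn // ltnW.
Qed.

Lemma fps_exp_qpoch4_0 : fps_exp (qpoch 4) 3 0%N = 1.
Proof.
by rewrite /= /fps_mul !big_ord1 /= /qpoch /qpoch_part big_geq // coef1.
Qed.

(* Main.v *)
Require Import Defs.
From mathcomp Require Import all_boot all_order all_algebra.
From mathcomp Require Import zify ring.
Set Implicit Arguments.
Unset Strict Implicit.
Unset Printing Implicit Defensive.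
Import Order.TTheory GRing.Theory Num.Theory.
Local Open Scope ring_scope.

(** By Jacobi's triple product, [f_1 f_3 f_6 / f_2] is the product of the theta
    series [sum (-1)^m q^(3m^2-2m)] and [sum (-1)^n q^(3n^2)].  Splitting the
    double sum by the parity of [m + n], with [(m, n) = (s+t, s-t)] or
    [(s+t+1, s-t)], gives
      [f_1 f_3 = (f_2 / f_6) (f(q^4,q^8)^2 - q f(q^2,q^10)^2)],
    where [f(a,b)] is Ramanujan's theta function.  A second use of the triple
    product turns [f_1 f_3 / f_4^3] into [E(q^2) - q O(q^2)] with, for
    [D_a = (q^a; q^12)_oo],
      [E = D_1 D_5 D_7 D_11 / (D_2^4 D_4^2 D_6 D_8^2 D_10^4 D_12)],
      [O = 1 / (D_1 D_5 D_7 D_11 D_4^2 D_6 D_8^2 D_12)].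
    Both [E(-q)], which contains [(1 + q) / (1 - q^2)], and [O], which contains
    [1 / (1 - q)], have positive coefficients.

    Identities between power series are proved modulo [q^M], that is, in
    commutative rings for an element [x] with [x ^+ M = 0]: there the infinite
    products and sums are finite and [1 - x ^+ k] is invertible. *)

(** * The Jacobi triple product *)

Lemma expr_ge_nilp (R : pzRingType) (y : R) (M k : nat) :
  y ^+ M = 0 -> (M <= k)%N -> y ^+ k = 0.
Proof. by move=> yM /subnK <-; rewrite exprD yM mulr0. Qed.

Lemma bin2S n : 'C(n.+1, 2) = ('C(n, 2) + n)%N.
Proof. by rewrite binS bin1. Qed.

Definition geom (R : pzRingType) (M : nat) (y : R) : R := \sum_(i < M) y ^+ i.

Lemma geom_inv (R : pzRingType) (M : nat) (y : R) :
  y ^+ M = 0 -> (1 - y) * geom M y = 1.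
Proof. by move=> yM; rewrite -opprB mulNr -subrX1 yM sub0r opprK. Qed.

(** * Gaussian binomial coefficients *)

Section QBinomial.
Variables (R : comNzRingType) (q : R).

(** The Gaussian binomial coefficient. A Pascal rule defines it because quotients of [qfact] values
    need not make sense in [R]; [qbin_fact] is the quotient formula with denominators cleared. *)
Fixpoint qbin (n i : nat) : R :=
  match n, i with
  | _, 0 => 1
  | 0, _.+1 => 0
  | n'.+1, i'.+1 => qbin n' i' + q ^+ i * qbin n' i
  end.

Definition qfact (n : nat) : R := \prod_(k < n) (1 - q ^+ k.+1).

Lemma qbinn0 n : qbin n 0%N = 1. Proof. by case: n. Qed.

Lemma qbinS n i : qbin n.+1 i.+1 = qbin n i + q ^+ i.+1 * qbin n i.+1.
Proof. by []. Qed.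

Lemma qbin_small n i : (n < i)%N -> qbin n i = 0.
Proof.
elim: n i => [|n IHn] [|i] //; rewrite ltnS => lt_ni.
by rewrite qbinS !IHn ?mulr0 ?addr0 // ltnW.
Qed.

(** The mirror Pascal rule: unfold by [qbinS], apply the induction hypothesis to both terms, refold
    by [qbinS]. In the triple product this rule handles a new factor in [a], and [qbinS] a new
    factor in [b]. *)
Lemma qbinSr n i :
  (i <= n)%N -> qbin n.+1 i.+1 = qbin n i.+1 + q ^+ (n - i) * qbin n i.
Proof.
elim: n i => [|n IHn] i; first by rewrite leqn0 => /eqP ->; rewrite /=; ring.
rewrite leq_eqVlt => /orP[/eqP->|].
  by rewrite subnn expr0 [qbin n.+2 _]qbinS (@qbin_small n.+1 n.+2) //; ring.
rewrite ltnS => le_in; rewrite [qbin n.+2 _]qbinS [qbin n.+1 i.+1 in LHS]IHn //.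
case: i le_in => [_|i lt_in].
  by rewrite !qbinn0 [qbin n.+1 1]qbinS qbinn0 subn0 subn0 [q ^+ n.+1]exprS; ring.
rewrite [qbin n.+1 i.+1 in LHS](IHn i) ?(ltnW lt_in) //.
rewrite [qbin n.+1 i.+2]qbinS [qbin n.+1 i.+1]qbinS.
rewrite subSS (_ : q ^+ (n - i) = q ^+ (n - i.+1) * q); last first.
  by rewrite -exprSr -subSn.
by rewrite [q ^+ i.+2]exprSr; ring.
Qed.

Lemma qfactS n : qfact n.+1 = qfact n * (1 - q ^+ n.+1).
Proof. by rewrite /qfact big_ord_recr. Qed.

Lemma qbin_fact m i : qbin (m + i) i * qfact i * qfact m = qfact (m + i).
Proof.
have [n le_n] := ubnP (m + i); elim: n => // n IHn in m i le_n *.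
case: i le_n => [|i] le_n.
  by rewrite addn0 qbinn0 /qfact big_ord0; ring.
case: m le_n => [|m] le_n.
  rewrite add0n qbinS (@qbin_small i i.+1) // mulr0 addr0 qfactS.
  have := IHn 0%N i; rewrite add0n {2}/qfact big_ord0 mulr1 => IH.
  by rewrite {2}/qfact big_ord0 mulr1 mulrA IH.
have IH1 := IHn m.+1 i; have IH2 := IHn m i.+1.
rewrite addnS qbinS qfactS [qfact m.+1]qfactS qfactS.
rewrite addSn in IH1; rewrite addnS in IH2.
rewrite mulrDl mulrDl addSn.
(* The last factor splits as 1 - q^(m+i+2) = (1 - q^(i+1)) + q^(i+1) (1 - q^(m+1)), one summand for
   each term of the Pascal rule. *)
transitivity (qfact (m + i).+1 * (1 - q ^+ i.+1) +
              qfact (m + i).+1 * (q ^+ i.+1 * (1 - q ^+ m.+1))); last first.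
  by rewrite -mulrDr (_ : (m + i).+2 = i.+1 + m.+1)%N ?exprD; [ring|lia].
congr (_ + _).
  by rewrite -IH1 ?qfactS; [ring | lia].
by rewrite -IH2 ?qfactS; [ring | lia].
Qed.

End QBinomial.

Arguments qbin : simpl never.

(** * The triple product: a finite form, then its limit for nilpotent [a] and [b] *)

Section JacobiTripleProduct.
Variables (R : comNzRingType) (a b : R).
Let q := a * b.

(* [theta z = a^(z(z+1)/2) b^(z(z-1)/2)], and [Negz j] is [-(j+1)]. *)
Definition theta (z : int) : R :=
  match z with
  | Posz j => a ^+ 'C(j.+1, 2) * b ^+ 'C(j, 2)
  | Negz j => a ^+ 'C(j.+1, 2) * b ^+ 'C(j.+2, 2)
  end.

Arguments theta : simpl never.

(** The ratio of [theta (z + 1)] to [theta z] is a q^z = q^(z+1) / b. Here and in [theta_pred],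
    powers of [q] are moved across so that all exponents are natural numbers. *)
Lemma theta_succ (m i : nat) : (i <= m)%N ->
  theta i * (a * q ^+ m) = q ^+ (m - i) * theta i.+1.
Proof.
move=> /subnKC {1}<-; rewrite /theta /q !exprMn !bin2S !exprD !exprS.
by ring.
Qed.

Lemma theta_pred (n i : nat) :
  theta (i%:Z - n%:Z) * (b * q ^+ n) = q ^+ i * theta (i%:Z - n.+1%:Z).
Proof.
(* The cases follow the two branches of [theta]: both indices nonnegative, the passage from 0 to -1,
   both negative. *)
rewrite /q; have [lt_ni|] := ltnP n i.
  have [j ->] : exists j, i = (n.+1 + j)%N by exists (i - n.+1)%N; lia.
  have [-> ->] : (n.+1 + j)%N%:Z - n%:Z = j.+1 /\ (n.+1 + j)%N%:Z - n.+1%:Z = j.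
    by split; lia.
  by rewrite /theta !exprMn !bin2S !exprD !exprS; ring.
rewrite leq_eqVlt => /orP[/eqP->|lt_in].
  have [-> ->] : n%:Z - n%:Z = 0%N /\ n%:Z - n.+1%:Z = Negz 0 by split; lia.
  by rewrite /theta /=; ring.
have [j ->] : exists j, n = (i.+1 + j)%N by exists (n - i.+1)%N; lia.
have [-> ->] : i%:Z - (i.+1 + j)%N%:Z = Negz j /\
               i%:Z - (i.+1 + j)%N.+1%:Z = Negz j.+1 by split; lia.
by rewrite /theta !exprMn !bin2S !exprD !exprS; ring.
Qed.

(** Induction on [n], whose base case is the q-binomial theorem by induction on [m]. A new factor
    shifts the theta terms by one, and a Pascal rule recombines the shifted sum with the old one. *)
Lemma finite_jacobi_triple m n :
  (\prod_(k < m) (1 + a * q ^+ k)) * (\prod_(k < n) (1 + b * q ^+ k)) =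
  \sum_(i < (m + n).+1) qbin q (m + n) i * theta (i%:Z - n%:Z).
Proof.
elim: n => [|n IHn].
  rewrite big_ord0 mulr1 addn0.
  rewrite [in RHS](eq_bigr (fun i : 'I__ => qbin q m i * theta i)).
    elim: m => [|m IHm]; first by rewrite big_ord0 big_ord1 qbinn0 /theta !mulr1.
    rewrite big_ord_recr /= IHm mulrDr mulr1 [in RHS]big_ord_recl /=.
    under [in RHS]eq_bigr => i _.
      have le_im : (i <= m)%N by rewrite -ltnS.
      rewrite /bump /= add1n qbinSr // mulrDl [q ^+ _ * _]mulrC -mulrA.
      rewrite -theta_succ // mulrA; over.
    rewrite big_split /= mulr_suml addrA; congr (_ + _).
    rewrite [in RHS]big_ord_recr /= (@qbin_small _ q m m.+1) // mul0r addr0.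
    by rewrite [in LHS]big_ord_recl !qbinn0.
  by move=> i _; rewrite subr0.
rewrite big_ord_recr /= mulrA IHn addnS [in RHS]big_ord_recl /= qbinn0.
under [in RHS]eq_bigr => i _.
  rewrite /bump /= add1n qbinS mulrDl.
  rewrite (_ : i.+1%:Z - n.+1%:Z = i%:Z - n%:Z); last by lia.
  rewrite (_ : q ^+ _ * _ * _ =
     qbin q (m + n) i.+1 * (q ^+ i.+1 * theta (i.+1%:Z - n.+1%:Z))); last first.
    by rewrite (_ : i.+1%:Z - n.+1%:Z = i%:Z - n%:Z); [ring | lia].
  rewrite -theta_pred; over.
rewrite big_split /= mulrDr mulr1 addrCA; congr (_ + _).
rewrite [in RHS]big_ord_recr /= (@qbin_small _ q (m + n) (m + n).+1) //.
rewrite mul0r addr0 mulr_suml.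
rewrite [in LHS]big_ord_recl /= qbinn0 !mul1r theta_pred expr0 mul1r.
congr (_ + _); apply: eq_bigr => i _.
by rewrite /bump leq0n add1n -mulrA.
Qed.

Variable M : nat.
Hypotheses (aM : a ^+ M = 0) (bM : b ^+ M = 0).

Lemma q_nilp : q ^+ M = 0. Proof. by rewrite exprMn aM mul0r. Qed.

Lemma qfact_absorb c L L' : (forall k, (L < k)%N -> q ^+ k * c = 0) ->
  (L <= L')%N -> qfact q L' * c = qfact q L * c.
Proof.
move=> qc0 /subnKC <-; elim: (L' - L)%N => [|d IHd]; first by rewrite addn0.
by rewrite addnS qfactS mulrAC mulrBr mulr1 -mulrA [c * _]mulrC qc0
  ?mulr0 ?subr0 // ltnS leq_addr.
Qed.

Lemma leq_binS2 p : (p <= 'C(p.+1, 2))%N.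
Proof. by rewrite binS bin1 leq_addl. Qed.

(** For [i < M] the exponent of [b] is at least k + (M - i), which exceeds [M]; otherwise q^k
    already vanishes. [q_theta0r] is the mirror statement, with [a] in place of [b]. *)
Lemma q_theta0 i k : (i < k)%N -> q ^+ k * theta (i%:Z - M%:Z) = 0.
Proof.
move=> lt_ik; have [le_Mi|lt_iM] := leqP M i.
  by rewrite (expr_ge_nilp q_nilp) ?mul0r //; lia.
have -> : i%:Z - M%:Z = Negz (M - i.+1) by lia.
rewrite /theta /q exprMn.
have bin_ge := leq_binS2 (M - i.+1).+1.
rewrite (_ : _ * _ * _ = a ^+ (k + 'C((M - i.+1).+1, 2)) *
   b ^+ (k + 'C((M - i.+1).+2, 2))); last by rewrite !exprD; ring.
by rewrite [b ^+ _](expr_ge_nilp bM) ?mulr0 //; lia.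
Qed.

Lemma q_theta0r i k : (i <= M + M)%N -> (M + M - i < k)%N ->
  q ^+ k * theta (i%:Z - M%:Z) = 0.
Proof.
move=> le_i2M lt_ik; have [le_iM|lt_Mi] := leqP i M.
  by rewrite (expr_ge_nilp q_nilp) ?mul0r //; lia.
have -> : i%:Z - M%:Z = (i - M)%N by lia.
rewrite /theta /q exprMn.
have bin_ge := leq_binS2 (i - M).
rewrite (_ : _ * _ * _ = a ^+ (k + 'C((i - M).+1, 2)) *
   b ^+ (k + 'C((i - M), 2))); last by rewrite !exprD; ring.
by rewrite [a ^+ _](expr_ge_nilp aM) ?mul0r //; lia.
Qed.

(** On the theta term, each of the three q-factorials acts like the unit [Q], since the missing
    factors 1 - q^k fix that term. The quotient formula then reads Q Q qbin t = Q t, and one [Q]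
    cancels. *)
Lemma qfact_qbin_theta i : (i <= M + M)%N ->
  qfact q M * qbin q (M + M) i * theta (i%:Z - M%:Z) = theta (i%:Z - M%:Z).
Proof.
move=> le_i; set t := theta _; set Q := qfact q (M + M).
have QM : qfact q M = Q.
  rewrite -[LHS]mulr1 -[RHS]mulr1 [RHS](@qfact_absorb 1 M) ?leq_addr // => k Mk.
  by rewrite (expr_ge_nilp q_nilp) ?mul0r // ltnW.
have Qi : qfact q i * t = Q * t.
  by rewrite (@qfact_absorb t i) // => k; apply: q_theta0.
have Qj : qfact q (M + M - i) * t = Q * t.
  by rewrite (@qfact_absorb t (M + M - i)) ?leq_subr // => k; apply: q_theta0r.
have [P PQ] : exists P, P * Q = 1.
  exists (\prod_(k < M + M) geom M (q ^+ k.+1)).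
  rewrite -big_split /= big1 // => k _; rewrite mulrC geom_inv //.
  by rewrite -exprM mulnC exprM q_nilp expr0n.
have QE : qbin q (M + M) i * qfact q i * qfact q (M + M - i) = Q.
  by rewrite /Q -[in RHS](subnK le_i) -qbin_fact subnK.
rewrite -[RHS]mul1r -PQ -[in RHS]QE.
transitivity (P * (qbin q (M + M) i * qfact q i * (qfact q (M + M - i) * t))).
  rewrite Qj; transitivity (P * Q * (qbin q (M + M) i * (qfact q i * t))).
    by rewrite PQ Qi QM; ring.
  by ring.
by ring.
Qed.

Lemma jacobi_triple_nilp :
  (\prod_(k < M) (1 + a * q ^+ k)) * (\prod_(k < M) (1 + b * q ^+ k)) *
    \prod_(k < M) (1 - q ^+ k.+1) =
  \sum_(i < (M + M).+1) theta (i%:Z - M%:Z).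
Proof.
rewrite finite_jacobi_triple mulr_suml; apply: eq_bigr => i _.
have le_i : (i <= M + M)%N by rewrite -ltnS.
by rewrite -[RHS](qfact_qbin_theta le_i) mulrC mulrA.
Qed.

End JacobiTripleProduct.

(** * Products of theta series *)

Definition zrange (M : nat) : seq int :=
  [seq i%:Z - M%:Z | i <- index_iota 0 (M + M).+1].

Lemma mem_zrange M z : (z \in zrange M) = (`|z| <= M)%N.
Proof.
apply/mapP/idP => [[i]|le_zM]; first by rewrite mem_index_iota => ? ->; lia.
by exists (absz (z + M%:Z)); rewrite ?mem_index_iota; lia.
Qed.

Lemma zrange_uniq M : uniq (zrange M).
Proof. by rewrite map_inj_uniq ?iota_uniq // => i j; lia. Qed.

(** Allows a change of variables in a truncated double sum even though it deforms the summation
    window. *)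
Lemma eq_big_support (I : eqType) (V : nmodType) (r1 r2 : seq I) (F : I -> V) :
  uniq r1 -> uniq r2 ->
  (forall i, F i != 0 -> (i \in r1) && (i \in r2)) ->
  \sum_(i <- r1) F i = \sum_(i <- r2) F i.
Proof.
move=> Ur1 Ur2 suppF; pose P i := F i != 0.
have FP r : \sum_(i <- r) F i = \sum_(i <- [seq i <- r | P i]) F i.
  by rewrite big_filter [RHS]big_rmcond // => i /negPn/eqP.
rewrite FP [RHS]FP; apply/perm_big/uniq_perm; rewrite ?filter_uniq //.
by move=> i; rewrite !mem_filter; case: (boolP (P i)) => //= /suppF/andP[-> ->].
Qed.

Section ThetaPowers.
Variables (R : comNzRingType) (x : R).

(** The exponent is al z(z+1)/2 + be z(z-1)/2; the hypothesis is doubled to avoid halving. *)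
Lemma thetaX (al be : nat) (z : int) (e : nat) :
  (e + e)%N%:Z = (al%:Z + be%:Z) * (z * z) + (al%:Z - be%:Z) * z ->
  theta (x ^+ al) (x ^+ be) z = x ^+ e.
Proof.
have bin2_double n : ('C(n, 2) + 'C(n, 2) + n = n * n)%N.
  by elim: n => // n IHn; rewrite bin2S; lia.
case: z => j ee; rewrite /theta -!exprM -exprD; congr (x ^+ _).
  have := bin2_double j; rewrite bin2S; move: 'C(j, 2) => c jj.
  have alj := congr1 (muln al) jj; have bej := congr1 (muln be) jj; nia.
have := bin2_double j.+1; rewrite ['C(j.+2, 2)]bin2S; move: 'C(j.+1, 2) => c jj.
have alj := congr1 (muln al) jj; have bej := congr1 (muln be) jj; nia.
Qed.

(** The two exponents add up to z^2, which has the parity of z. *)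
Lemma theta_opp (a b : R) z : theta (- a) (- b) z = (-1) ^+ `|z| * theta a b z.
Proof.
case: z => j; rewrite /theta [(- a) ^+ _]exprNn [(- b) ^+ _]exprNn mulrACA -exprD;
  congr (_ * _).
  by rewrite bin2S -[LHS]signr_odd -[RHS]signr_odd; congr (_ ^+ _); lia.
by rewrite ['C(j.+2, 2)]bin2S -[LHS]signr_odd -[RHS]signr_odd; congr (_ ^+ _); lia.
Qed.

End ThetaPowers.

Section ThetaProduct.
Variables (R : comNzRingType) (x : R) (M : nat).
Hypothesis xM : x ^+ M = 0.

Definition theta_sum (a b : R) : R := \sum_(z <- zrange M) theta a b z.

Lemma theta_product :
  theta_sum (- x) (- x ^+ 5) * theta_sum (- x ^+ 3) (- x ^+ 3) =
  theta_sum (x ^+ 4) (x ^+ 8) ^+ 2 - x * theta_sum (x ^+ 10) (x ^+ 2) ^+ 2.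
Proof.
pose e (p : int * int) := (absz (3 * (p.1 * p.1) - 2 * p.1 + 3 * (p.2 * p.2)%R)).
pose F p := (-1) ^+ (`|p.1| + `|p.2|)%N * x ^+ e p.
pose box := [seq (m, n) | m <- zrange M, n <- zrange M].
have box_uniq : uniq box.
  by apply: allpairs_uniq => [||[? ?] [? ?]] //; apply: zrange_uniq.
have mem_box p : (p \in box) = (`|p.1| <= M)%N && (`|p.2| <= M)%N.
  case: p => m n; rewrite -!mem_zrange; apply/allpairsP/andP => /=.
    by case=> -[m' n'] /= [? ? [-> ->]].
  by case=> ? ?; exists (m, n).
(* With p = (s, t), the exponent [e] becomes (6s^2 - 2s) + (6t^2 - 2t) along [ev] and 1 + (6s^2 +
   4s) + (6t^2 + 4t) along [od]. Both separate, and the sign is constant because m + n is 2s or 2s +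
   1. *)
pose ev (p : int * int) := (p.1 + p.2, p.1 - p.2).
pose od (p : int * int) := (p.1 + p.2 + 1, p.1 - p.2).
have -> : theta_sum (- x) (- x ^+ 5) * theta_sum (- x ^+ 3) (- x ^+ 3) =
  \sum_(p <- box) F p.
  rewrite /theta_sum big_distrlr /= big_allpairs /=.
  apply: eq_bigr => m _; apply: eq_bigr => n _.
  rewrite !theta_opp -[x in theta x]expr1.
  rewrite (@thetaX _ x 1 5 m (absz (3 * (m * m) - 2 * m)%R)); last by nia.
  rewrite (@thetaX _ x 3 3 n (absz (3 * (n * n))%R)); last by nia.
  rewrite mulrACA -!exprD /F /e /=; congr (_ * x ^+ _); nia.
have -> : theta_sum (x ^+ 4) (x ^+ 8) ^+ 2 = \sum_(p <- map ev box) F p.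
  rewrite [RHS]big_map [RHS]big_allpairs expr2 /theta_sum big_distrlr /=.
  apply: eq_bigr => s _; apply: eq_bigr => t _.
  rewrite (@thetaX _ x 4 8 s (absz (6 * (s * s) - 2 * s)%R)); last by nia.
  rewrite (@thetaX _ x 4 8 t (absz (6 * (t * t) - 2 * t)%R)); last by nia.
  rewrite /F -signr_odd (_ : odd _ = false) /=; last by lia.
  rewrite expr0 mul1r -exprD /e /=; congr (x ^+ _); nia.
have -> : - (x * theta_sum (x ^+ 10) (x ^+ 2) ^+ 2) =
    \sum_(p <- map od box) F p.
  rewrite [RHS]big_map [RHS]big_allpairs expr2 /theta_sum big_distrlr /=.
  rewrite mulr_sumr -sumrN.
  apply: eq_bigr => s _; rewrite mulr_sumr -sumrN; apply: eq_bigr => t _.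
  rewrite (@thetaX _ x 10 2 s (absz (6 * (s * s) + 4 * s)%R)); last by nia.
  rewrite (@thetaX _ x 10 2 t (absz (6 * (t * t) + 4 * t)%R)); last by nia.
  rewrite /F -signr_odd (_ : odd _ = true) /=; last by lia.
  rewrite expr1 mulN1r -exprD -exprS /e /=; congr (- x ^+ _); nia.
(* The images of the box under [ev] and [od] are disjoint by parity. They do not fill the box
   exactly, but a nonzero term has exponent below [M], which puts its index in the box and its
   preimage in the box too. *)
rewrite -big_cat; apply: eq_big_support => //.
  rewrite cat_uniq !map_inj_uniq ?box_uniq ?andTb ?andbT.
  - apply/hasPn => _ /mapP[[s t] _ ->]; apply/mapP => -[[s' t'] _].
    by case; lia.
  - by move=> [s t] [s' t'] []; rewrite /= => h1 h2; congr pair; lia.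
  - by move=> [s t] [s' t'] []; rewrite /= => h1 h2; congr pair; lia.
move=> p Fp0; have {Fp0} lt_eM : (e p < M)%N.
  rewrite ltnNge; apply: contra Fp0 => /(expr_ge_nilp xM) xe0.
  by rewrite /F xe0 mulr0.
case: p lt_eM => m n lt_eM; rewrite /e /= in lt_eM.
have le_m : (`|m| <= M)%N by nia.
have le_n : (`|n| <= M)%N by nia.
apply/andP; split; first by rewrite mem_box; apply/andP.
rewrite mem_cat; apply/orP.
have [mn_odd|mn_even] := boolP (odd (`|m| + `|n|)); [right|left].
  apply/mapP; exists (((m + n - 1) %/ 2)%Z, ((m - n - 1) %/ 2)%Z).
    by rewrite mem_box /=; lia.
  by rewrite /od /=; congr pair; lia.
apply/mapP; exists (((m + n) %/ 2)%Z, ((m - n) %/ 2)%Z).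
  by rewrite mem_box /=; lia.
by rewrite /ev /=; congr pair; lia.
Qed.

End ThetaProduct.

(** * Dissection of [f_1 f_3] *)

Section Products.
Variables (R : comNzRingType) (M : nat).
Implicit Type x : R.

(* [qpm x m a], [qpp x m a] and [qpi x m a] stand for [(x^a; x^m)_oo],
   [(-x^a; x^m)_oo] and [1 / (x^a; x^m)_oo] when [x ^+ M = 0]. *)
Definition qpm x (m a : nat) : R := \prod_(k < M) (1 - x ^+ (m * k + a)).
Definition qpp x (m a : nat) : R := \prod_(k < M) (1 + x ^+ (m * k + a)).
Definition qpi x (m a : nat) : R := \prod_(k < M) geom M (x ^+ (m * k + a)).

Lemma expX_nilp x k : x ^+ M = 0 -> (0 < k)%N -> (x ^+ k) ^+ M = 0.
Proof. by move=> xM k_gt0; rewrite -exprM (expr_ge_nilp xM) // leq_pmull. Qed.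

Lemma qpmE x m a N : x ^+ M = 0 -> (0 < m)%N -> (M <= N)%N ->
  \prod_(0 <= k < N) (1 - x ^+ (m * k + a)) = qpm x m a.
Proof.
move=> xM m_gt0 le_MN; rewrite (big_cat_nat (leq0n M) le_MN) /= big_mkord.
rewrite [X in _ * X]big1_seq ?mulr1 // => k; rewrite mem_index_iota => /andP[_ Mk].
by rewrite (expr_ge_nilp xM) ?subr0 //; nia.
Qed.

Lemma qpm_qpi x m a : x ^+ M = 0 -> (0 < a)%N -> qpm x m a * qpi x m a = 1.
Proof.
move=> xM a_gt0; rewrite -big_split /= big1 // => k _; apply: geom_inv.
by apply: expX_nilp; rewrite // ltn_addl.
Qed.

Lemma qpp_qpm x m a : qpp x m a * qpm x m a = qpm x (2 * m) (2 * a).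
Proof.
rewrite -big_split /=; apply: eq_bigr => k _.
rewrite (_ : (2 * m * k + 2 * a = (m * k + a) * 2)%N) ?exprM; [ring | lia].
Qed.

(** Sorts the factors by their index modulo [d]. The right side has M d factors in all; those beyond
    the first [M] equal 1. *)
Lemma qpm_split x m a d : x ^+ M = 0 -> (0 < m)%N -> (0 < d)%N ->
  qpm x m a = \prod_(r < d) qpm x (m * d) (m * r + a).
Proof.
move=> xM m_gt0 d_gt0; rewrite -(@qpmE x m a (M * d)) ?leq_pmulr //.
rewrite exchange_big /= big_nat_mul big_mkord; apply: eq_bigr => k _.
rewrite -{1}[(k * d)%N]add0n big_addn mulSn addnK big_mkord.
by apply: eq_bigr => r _; congr (1 - x ^+ _); lia.
Qed.

Lemma qpmX x d m a : qpm (x ^+ d) m a = qpm x (d * m) (d * a).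
Proof. by apply: eq_bigr => k _; rewrite -exprM; congr (1 - x ^+ _); lia. Qed.

Lemma qppX x d m a : qpp (x ^+ d) m a = qpp x (d * m) (d * a).
Proof. by apply: eq_bigr => k _; rewrite -exprM; congr (1 + x ^+ _); lia. Qed.

Lemma theta_sum_triple (a b : R) : a ^+ M = 0 -> b ^+ M = 0 ->
  theta_sum M a b = (\prod_(k < M) (1 + a * (a * b) ^+ k)) *
    (\prod_(k < M) (1 + b * (a * b) ^+ k)) * \prod_(k < M) (1 - (a * b) ^+ k.+1).
Proof.
move=> aM bM; rewrite jacobi_triple_nilp // /theta_sum /zrange big_map.
by rewrite big_mkord.
Qed.

Lemma theta_sum_qpp x a b : x ^+ M = 0 -> (0 < a)%N -> (0 < b)%N ->
  theta_sum M (x ^+ a) (x ^+ b) =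
  qpp x (a + b) a * qpp x (a + b) b * qpm x (a + b) (a + b).
Proof.
move=> xM a_gt0 b_gt0; rewrite theta_sum_triple ?expX_nilp // -exprD.
congr (_ * _ * _); apply: eq_bigr => k _; rewrite -exprM -?exprD;
  congr (1 + _); congr (x ^+ _) || congr (- x ^+ _); lia.
Qed.

Lemma theta_sum_qpm x a b : x ^+ M = 0 -> (0 < a)%N -> (0 < b)%N ->
  theta_sum M (- x ^+ a) (- x ^+ b) =
  qpm x (a + b) a * qpm x (a + b) b * qpm x (a + b) (a + b).
Proof.
move=> xM a_gt0 b_gt0; rewrite theta_sum_triple; last 2 first.
- by rewrite exprNn expX_nilp ?mulr0.
- by rewrite exprNn expX_nilp ?mulr0.
rewrite mulrNN -exprD; congr (_ * _ * _); apply: eq_bigr => k _;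
  rewrite ?mulNr -exprM -?exprD; congr (1 - x ^+ _); lia.
Qed.

(** The left side is f_2 times the product of theta series in [theta_product]: f_1 / f_2 = (x;
    x^2)_oo splits modulo 6, and f_3 = (x^3; x^6)_oo f_6. *)
Lemma f1_f3_dissection x : x ^+ M = 0 ->
  qpm x 1 1 * qpm x 3 3 * qpm x 6 6 =
  qpm x 2 2 * ((qpp x 12 4 * qpp x 12 8 * qpm x 12 12) ^+ 2
               - x * (qpp x 12 2 * qpp x 12 10 * qpm x 12 12) ^+ 2).
Proof.
move=> xM; rewrite -(@theta_sum_qpp x 4 8) // [qpp x 12 2 * _]mulrC.
rewrite -(@theta_sum_qpp x 10 2) // -(theta_product xM).
rewrite -[x in theta_sum M (- x)]expr1.
rewrite !theta_sum_qpm // (@qpm_split x 1 1 2) // (@qpm_split x 3 3 2) //.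
rewrite !big_ord_recl !big_ord0 (@qpm_split x 2 1 3) // !big_ord_recl !big_ord0 /=.
rewrite !mulr1; ring.
Qed.

(** * The series [E] and [O] as products modulo 12 *)

Definition even_part x : R :=
  qpm x 12 1 * qpm x 12 5 * qpm x 12 7 * qpm x 12 11 *
  (qpi x 12 2 ^+ 4 * qpi x 12 10 ^+ 4 * qpi x 12 4 ^+ 2 * qpi x 12 8 ^+ 2 *
   qpi x 12 6 * qpi x 12 12).

Definition odd_part x : R :=
  qpi x 12 1 * qpi x 12 5 * qpi x 12 7 * qpi x 12 11 *
  (qpi x 12 4 ^+ 2 * qpi x 12 8 ^+ 2 * qpi x 12 6 * qpi x 12 12).

Section Parts.
Variable y : R.
Hypothesis yM : y ^+ M = 0.

Let f1_split : qpm y 1 1 = qpm y 12 1 * qpm y 12 2 * qpm y 12 3 * qpm y 12 4 *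
  qpm y 12 5 * qpm y 12 6 * qpm y 12 7 * qpm y 12 8 * qpm y 12 9 *
  qpm y 12 10 * qpm y 12 11 * qpm y 12 12.
Proof.
by rewrite (@qpm_split y 1 1 12) // !big_ord_recl big_ord0 !mulrA mulr1.
Qed.

Let f2_split : qpm y 2 2 = qpm y 12 2 * qpm y 12 4 * qpm y 12 6 * qpm y 12 8 *
  qpm y 12 10 * qpm y 12 12.
Proof.
by rewrite (@qpm_split y 2 2 6) // !big_ord_recl big_ord0 !mulrA mulr1.
Qed.

Let f3_split : qpm y 3 3 = qpm y 12 3 * qpm y 12 6 * qpm y 12 9 * qpm y 12 12.
Proof.
by rewrite (@qpm_split y 3 3 4) // !big_ord_recl big_ord0 !mulrA mulr1.
Qed.

Let split6 a : qpm y 6 a = qpm y 12 a * qpm y 12 (6 + a).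
Proof. by rewrite (@qpm_split y 6 a 2) // !big_ord_recl big_ord0 mulr1. Qed.

Let qpp6 a : (0 < a)%N ->
  qpp y 6 a = qpm y 12 (2 * a) * qpi y 12 a * qpi y 12 (6 + a).
Proof.
move=> a_gt0; rewrite -(qpp_qpm y 6 a) split6.
transitivity (qpp y 6 a * (qpm y 12 a * qpi y 12 a) *
                          (qpm y 12 (6 + a) * qpi y 12 (6 + a))); last by ring.
by rewrite !qpm_qpi ?mulr1 // addn_gt0 a_gt0 orbT.
Qed.

(** In y = x^2 the prefactor f_2 / (f_6 f_4^3) becomes f_1 / (f_3 f_2^3); the identity for [E] is
    stated with this denominator cleared, and so is [odd_partP] for [O]. *)
Lemma even_partP :
  qpm y 1 1 * (qpp y 6 2 * qpp y 6 4 * qpm y 6 6) ^+ 2 =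
  even_part y * (qpm y 3 3 * qpm y 2 2 ^+ 3).
Proof.
have e2 : qpp y 6 2 = qpm y 12 4 * qpi y 12 2 * qpi y 12 8 by exact: qpp6.
have e4 : qpp y 6 4 = qpm y 12 8 * qpi y 12 4 * qpi y 12 10 by exact: qpp6.
have e6 : qpm y 6 6 = qpm y 12 6 * qpm y 12 12 by exact: split6.
rewrite f1_split f2_split f3_split e2 e4 e6 /even_part.
have DI a : (0 < a)%N -> qpm y 12 a * qpi y 12 a = 1 by exact: qpm_qpi.
(* [C] is the common reduced form of both sides, each of which is [C] times products
   [qpm y 12 a * qpi y 12 a] equal to 1. *)
set C := qpm y 12 1 * qpm y 12 5 * qpm y 12 7 * qpm y 12 11 * qpm y 12 3 *
  qpm y 12 9 * qpm y 12 4 * qpm y 12 8 * qpm y 12 6 ^+ 3 * qpm y 12 12 ^+ 3 *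
  qpi y 12 2 * qpi y 12 10.
transitivity (C * (qpm y 12 2 * qpi y 12 2) * (qpm y 12 10 * qpi y 12 10) *
  (qpm y 12 4 * qpi y 12 4) ^+ 2 * (qpm y 12 8 * qpi y 12 8) ^+ 2).
  by rewrite /C; ring.
transitivity (C * (qpm y 12 2 * qpi y 12 2) ^+ 3 *
  (qpm y 12 10 * qpi y 12 10) ^+ 3 * (qpm y 12 4 * qpi y 12 4) ^+ 2 *
  (qpm y 12 8 * qpi y 12 8) ^+ 2 * (qpm y 12 6 * qpi y 12 6) *
  (qpm y 12 12 * qpi y 12 12)).
  by rewrite !DI // !expr1n !mulr1.
by rewrite /C; ring.
Qed.

Lemma odd_partP :
  qpm y 1 1 * (qpp y 6 1 * qpp y 6 5 * qpm y 6 6) ^+ 2 =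
  odd_part y * (qpm y 3 3 * qpm y 2 2 ^+ 3).
Proof.
have e1 : qpp y 6 1 = qpm y 12 2 * qpi y 12 1 * qpi y 12 7 by exact: qpp6.
have e5 : qpp y 6 5 = qpm y 12 10 * qpi y 12 5 * qpi y 12 11 by exact: qpp6.
have e6 : qpm y 6 6 = qpm y 12 6 * qpm y 12 12 by exact: split6.
rewrite f1_split f2_split f3_split e1 e5 e6 /odd_part.
have DI a : (0 < a)%N -> qpm y 12 a * qpi y 12 a = 1 by exact: qpm_qpi.
set C := qpi y 12 1 * qpi y 12 5 * qpi y 12 7 * qpi y 12 11 *
  qpm y 12 2 ^+ 3 * qpm y 12 10 ^+ 3 * qpm y 12 6 ^+ 3 * qpm y 12 12 ^+ 3 *
  qpm y 12 3 * qpm y 12 9 * qpm y 12 4 * qpm y 12 8.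
transitivity (C * (qpm y 12 1 * qpi y 12 1) * (qpm y 12 5 * qpi y 12 5) *
  (qpm y 12 7 * qpi y 12 7) * (qpm y 12 11 * qpi y 12 11)).
  by rewrite /C; ring.
transitivity (C * (qpm y 12 4 * qpi y 12 4) ^+ 2 *
  (qpm y 12 8 * qpi y 12 8) ^+ 2 * (qpm y 12 6 * qpi y 12 6) *
  (qpm y 12 12 * qpi y 12 12)).
  by rewrite !DI // !expr1n !mulr1.
by rewrite /C; ring.
Qed.

End Parts.

(** In the dissection everything but [A] and a single [x] depends only on y = x^2. The factor [u],
    which is f_6 f_4^3 in terms of [x], has inverse [v] and cancels. *)
Lemma f1_f3_quotient x A : x ^+ M = 0 ->
  A * qpm x 4 4 ^+ 3 = qpm x 1 1 * qpm x 3 3 ->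
  A = even_part (x ^+ 2) - x * odd_part (x ^+ 2).
Proof.
move=> xM eqA; have yM : (x ^+ 2) ^+ M = 0 by apply: expX_nilp.
have := f1_f3_dissection xM; rewrite -eqA.
rewrite -!(qpmX x 2 2 2, qpmX x 2 3 3, qpmX x 2 1 1, qpmX x 2 6 6).
rewrite -!(qppX x 2 6 2, qppX x 2 6 4, qppX x 2 6 1, qppX x 2 6 5).
move: (even_partP yM) (odd_partP yM) (qpm_qpi 3 yM (isT : 0 < 3)%N).
move: (qpm_qpi 2 yM (isT : 0 < 2)%N); move: (x ^+ 2) => y f2V eE oO f3V eqA2.
set u := qpm y 3 3 * qpm y 2 2 ^+ 3; set v := qpi y 3 3 * qpi y 2 2 ^+ 3.
have uv : u * v = 1.
  transitivity ((qpm y 3 3 * qpi y 3 3) * (qpm y 2 2 * qpi y 2 2) ^+ 3).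
    by rewrite /u /v; ring.
  by rewrite f2V f3V; ring.
have Au : A * u = (even_part y - x * odd_part y) * u.
  transitivity (A * qpm y 2 2 ^+ 3 * qpm y 3 3); first by rewrite /u; ring.
  by rewrite eqA2 mulrBr eE [X in _ - X]mulrCA oO -/u; ring.
by rewrite -[LHS]mulr1 -[RHS]mulr1 -uv mulrA Au mulrA.
Qed.

End Products.

(** * Positivity and truncated power series *)

Section Morphism.
Variables (A B : comNzRingType) (f : {rmorphism A -> B}) (M : nat).

Lemma rmorph_qpm x m a : f (qpm M x m a) = qpm M (f x) m a.
Proof.
rewrite rmorph_prod; apply: eq_bigr => k _.
by rewrite rmorphB rmorph1 rmorphXn.
Qed.

Lemma rmorph_qpi x m a : f (qpi M x m a) = qpi M (f x) m a.
Proof.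
rewrite rmorph_prod; apply: eq_bigr => k _; rewrite rmorph_sum.
by apply: eq_bigr => i _; rewrite !rmorphXn.
Qed.

(** Serves both for reduction modulo a power of ['X] and for the substitutions of ['X^2] and
    [- 'X]. *)
Lemma rmorph_even_part x : f (even_part M x) = even_part M (f x).
Proof. by rewrite !(rmorphM, rmorphXn, rmorph_qpm, rmorph_qpi). Qed.

Lemma rmorph_odd_part x : f (odd_part M x) = odd_part M (f x).
Proof. by rewrite !(rmorphM, rmorphXn, rmorph_qpi). Qed.

End Morphism.

Section Positivity.
Implicit Types p q : {poly int}.

(** The constant term 1 ensures that multiplying by such a polynomial keeps positive coefficients
    positive ([coef_mul_gt0]). *)
Definition nneg_poly1 p := (forall i, 0 <= p`_i) /\ p`_0 = 1.

Lemma nneg_poly1_1 : nneg_poly1 1.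
Proof. by split=> [i|]; rewrite coef1 ?ler0n. Qed.

Lemma nneg_poly1M p q : nneg_poly1 p -> nneg_poly1 q -> nneg_poly1 (p * q).
Proof.
move=> [pp p0] [qq q0]; split=> [i|]; rewrite coefM; last first.
  by rewrite big_ord1 p0 q0.
by apply: sumr_ge0 => j _; rewrite mulr_ge0.
Qed.

Lemma nneg_poly1X p k : nneg_poly1 p -> nneg_poly1 (p ^+ k).
Proof.
move=> pp; elim: k => [|k IHk]; first exact: nneg_poly1_1.
by rewrite exprS; apply: nneg_poly1M.
Qed.

Lemma nneg_poly1_prod (I : Type) (r : seq I) (P : pred I) (F : I -> {poly int}) :
  (forall i, P i -> nneg_poly1 (F i)) -> nneg_poly1 (\prod_(i <- r | P i) F i).
Proof. by apply: big_ind; [apply: nneg_poly1_1 | apply: nneg_poly1M]. Qed.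

Lemma coef_mul_gt0 p q i : nneg_poly1 p -> nneg_poly1 q -> 0 < p`_i ->
  0 < (p * q)`_i.
Proof.
move=> [pp _] [qq q0] pi_gt0; rewrite coefM big_ord_recr /= subnn q0 mulr1.
by rewrite ltr_wpDl // sumr_ge0 // => j _; rewrite mulr_ge0.
Qed.

Lemma nneg_poly1_1DXn k : (0 < k)%N -> nneg_poly1 (1 + 'X^k).
Proof.
move=> k_gt0; split=> [i|]; rewrite coefD coef1 coefXn ?addr_ge0 ?ler0n //.
by rewrite -(prednK k_gt0).
Qed.

Variable M : nat.

Lemma coef_geomX N i : (geom N 'X : {poly int})`_i = (i < N)%:R.
Proof.
have -> : geom N 'X = \poly_(j < N) 1 :> {poly int}.
  by rewrite poly_def; apply: eq_bigr => j _; rewrite scale1r.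
by rewrite coef_poly; case: ifP.
Qed.

Lemma nneg_poly1_geom k : (0 < k)%N -> nneg_poly1 (geom M.+1 'X^k).
Proof.
move=> k_gt0; split=> [i|].
  by rewrite coef_sum sumr_ge0 // => j _; rewrite -exprM coefXn ler0n.
rewrite /geom big_ord_recl coefD expr0 coef1 coef_sum big1 ?addr0 // => j _.
by rewrite -exprM coefXn; case: k k_gt0.
Qed.

Lemma nneg_poly1_qpp m a : (0 < a)%N -> nneg_poly1 (qpp M.+1 'X m a).
Proof.
move=> a_gt0; apply: nneg_poly1_prod => k _; apply: nneg_poly1_1DXn.
by rewrite ltn_addl.
Qed.

Lemma nneg_poly1_qpi m a : (0 < a)%N -> nneg_poly1 (qpi M.+1 'X m a).
Proof.
move=> a_gt0; apply: nneg_poly1_prod => k _; apply: nneg_poly1_geom.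
by rewrite ltn_addl.
Qed.

Ltac nneg_poly1_tac := repeat first [assumption | apply: nneg_poly1_qpi => //
  | apply: nneg_poly1_qpp => // | apply: nneg_poly1X | apply: nneg_poly1M].

Lemma odd_part_gt0 i : (i < M.+1)%N -> 0 < (odd_part M.+1 ('X : {poly int}))`_i.
Proof.
move=> lt_iM; have [p pp ->] : exists2 p, nneg_poly1 p &
    odd_part M.+1 'X = geom M.+1 'X * p.
  (* The factor [k = 0] of [qpi 'X 12 1] is the truncation of 1 / (1 - X), whose coefficients are
     all 1 up to degree [M]. *)
  rewrite /odd_part {1}/qpi big_ord_recl muln0 add0n expr1.
  set r := \prod_(_ < M) _.
  have rr : nneg_poly1 r.
    by apply: nneg_poly1_prod => k _; apply: nneg_poly1_geom; rewrite addn1.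
  by eexists; last (rewrite -!mulrA; reflexivity); nneg_poly1_tac.
by apply: coef_mul_gt0 => //;
  [apply: (@nneg_poly1_geom 1) | rewrite coef_geomX lt_iM].
Qed.

Lemma even_part_gt0 i :
  (i < M.+1)%N -> 0 < (even_part M.+1 (- 'X : {poly int}))`_i.
Proof.
(* Since 12 is even, 12 k + a has the parity of [a]: the sign change turns the numerator factors
   into 1 + X^j and leaves the denominators alone. *)
have qpmN a : odd a -> qpm M.+1 (- 'X : {poly int}) 12 a = qpp M.+1 'X 12 a.
  move=> odd_a; apply: eq_bigr => k _; rewrite exprNn -signr_odd oddD oddM /= odd_a.
  by rewrite mulN1r opprK.
have qpiN a : ~~ odd a -> qpi M.+1 (- 'X : {poly int}) 12 a = qpi M.+1 'X 12 a.
  move=> /negPf odd_a; apply: eq_bigr => k _.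
  by rewrite exprNn -signr_odd oddD oddM /= odd_a mul1r.
move=> lt_iM; have [p pp ->] : exists2 p, nneg_poly1 p &
    even_part M.+1 (- 'X) = ((1 + 'X) * geom M.+1 'X^2) * p.
  (* The factors [k = 0] of [qpp 'X 12 1] and of one copy of [qpi 'X 12 2] are isolated. *)
  rewrite /even_part !qpmN // !qpiN // {1}/qpp big_ord_recl.
  rewrite [qpi _ _ _ 2 ^+ 4]exprS {1}/qpi [\prod_(k < M.+1) geom _ _]big_ord_recl.
  rewrite !muln0 !add0n expr1.
  set r := \prod_(_ < M) _; set s := \prod_(_ < M) _.
  have rr : nneg_poly1 r.
    by apply: nneg_poly1_prod => k _; apply: nneg_poly1_1DXn; rewrite addn1.
  have ss : nneg_poly1 s.
    by apply: nneg_poly1_prod => k _; apply: nneg_poly1_geom; rewrite addn2.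
  exists (r * qpp M.+1 'X 12 5 * qpp M.+1 'X 12 7 * qpp M.+1 'X 12 11 *
    (s * qpi M.+1 'X 12 2 ^+ 3 * qpi M.+1 'X 12 10 ^+ 4 * qpi M.+1 'X 12 4 ^+ 2 *
     qpi M.+1 'X 12 8 ^+ 2 * qpi M.+1 'X 12 6 * qpi M.+1 'X 12 12)).
    by nneg_poly1_tac.
  by ring.
have base1 : nneg_poly1 ((1 + 'X) * geom M.+1 'X^2).
  by apply: nneg_poly1M; [apply: (@nneg_poly1_1DXn 1) | apply: nneg_poly1_geom].
apply: coef_mul_gt0 => //.
(* Truncated form of (1 + X) / (1 - X^2) = 1 / (1 - X). *)
have -> : (1 + 'X) * geom M.+1 'X^2 = geom (2 * M.+1) 'X :> {poly int}.
  rewrite /geom; elim: {lt_iM p pp base1 qpmN qpiN} M.+1 => [|k IHk].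
    by rewrite !big_ord0 mulr0.
  rewrite mulnS addnC addn2 big_ord_recr mulrDr IHk 2!big_ord_recr /= -exprM.
  by rewrite -addrA mulrDl mul1r -exprS.
by rewrite coef_geomX (_ : (i < _)%N = true) //; lia.
Qed.

End Positivity.

Lemma coef_comp_polyNX (p : {poly int}) i :
  (p \Po (- 'X))`_i = (-1) ^+ i * p`_i.
Proof.
rewrite comp_polyE coef_sum (eq_bigr (fun j : 'I__ =>
  if (j == i :> nat) then (-1) ^+ i * p`_i else 0)); last first.
  move=> j _; rewrite -scaleN1r exprZn !coefZ coefXn eq_sym.
  by case: eqP => [->|_]; rewrite ?mulr0 // mulr1 mulrC.
rewrite -big_mkcond /=; have [lt_ip|le_pi] := ltnP i (size p).
  by rewrite (big_pred1 (Ordinal lt_ip)).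
by rewrite nth_default // mulr0 big1.
Qed.

(** * Formal power series modulo a power of ['X] *)

Section Truncation.
Implicit Types p q : {poly int}.
Variable M : nat.
Let modulus : {poly int} := 'X^(M.+1).
Let modX (p : {poly int}) : {poly %/ modulus} := in_qpoly modulus p.

Lemma coef_modX p i : (i < M.+1)%N -> (modX p)`_i = p`_i.
Proof.
move=> lt_iM; rewrite /modX /= mk_monic_Xn /= -Pdiv.RingMonic.take_poly_rmodp.
by rewrite coef_take_poly lt_iM.
Qed.

Lemma eq_modX p q : (forall i, (i < M.+1)%N -> p`_i = q`_i) -> modX p = modX q.
Proof.
move=> pq; apply: val_inj; rewrite /= mk_monic_Xn /= -!Pdiv.RingMonic.take_poly_rmodp.
by apply/polyP => i; rewrite !coef_take_poly; case: ifP => // /pq.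
Qed.

Lemma modXX_nilp : modX 'X ^+ M.+1 = 0.
Proof.
rewrite -rmorphXn -(rmorph0 (in_qpoly modulus)); apply: eq_modX => i lt_iM.
by rewrite coefXn coef0 ltn_eqF.
Qed.

Definition fps_mod (f : fps) := modX (\poly_(i < M.+1) f i).

Lemma eq_fps_mod f g : f =1 g -> fps_mod f = fps_mod g.
Proof. by move=> fg; apply: eq_modX => i lt_iM; rewrite !coef_poly lt_iM. Qed.

Lemma fps_mod1 : fps_mod fps1 = 1.
Proof.
rewrite -(rmorph1 (in_qpoly modulus)); apply: eq_modX => i lt_iM.
by rewrite coef_poly lt_iM coef1.
Qed.

Lemma fps_modM f g : fps_mod (fps_mul f g) = fps_mod f * fps_mod g.
Proof.
rewrite -rmorphM; apply: eq_modX => i lt_iM.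
rewrite coef_poly lt_iM coefM; apply: eq_bigr => j _.
have lt_jM : (j < M.+1)%N by apply: leq_trans (ltn_ord j) _.
by rewrite !coef_poly lt_jM (leq_ltn_trans (leq_subr _ _) lt_iM).
Qed.

Lemma fps_modX f k : fps_mod (fps_exp f k) = fps_mod f ^+ k.
Proof.
elim: k => [|k IHk]; first exact: fps_mod1.
by rewrite exprS -IHk -fps_modM.
Qed.

Lemma fps_mod_div f g : g 0%N \is a GRing.unit ->
  fps_mod (fps_div f g) * fps_mod g = fps_mod f.
Proof.
move=> g0; rewrite fps_modM mulrAC -mulrA -fps_modM.
by rewrite (eq_fps_mod (fps_mulfV g0)) fps_mod1 mulr1.
Qed.

Lemma fps_mod_qpoch j : (0 < j)%N -> fps_mod (qpoch j) = qpm M.+1 (modX 'X) j j.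
Proof.
move=> j_gt0; have E : qpoch_part j M.+1 = qpm M.+1 'X j j.
  rewrite /qpoch_part big_add1 big_mkord; apply: eq_bigr => k _.
  by rewrite mulnS addnC.
rewrite -rmorph_qpm -E; apply: eq_modX => i lt_iM.
by rewrite coef_poly lt_iM qpochE // ltnW.
Qed.

(** The class of ['X] is nilpotent in the quotient ring, so [f1_f3_quotient] applies to the class of
    the series; coefficients below [M.+1] survive the reduction. *)
Lemma coef_a_1_3_m4 i : (i < M.+1)%N ->
  a_1_3_m4 i =
  (even_part M.+1 ('X ^+ 2) - 'X * odd_part M.+1 ('X ^+ 2) : {poly int})`_i.
Proof.
move=> lt_iM.
suff eqA : fps_mod a_1_3_m4 =
    modX (even_part M.+1 ('X ^+ 2) - 'X * odd_part M.+1 ('X ^+ 2)).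
  by rewrite -coef_modX // -eqA coef_modX // coef_poly lt_iM.
rewrite /modX rmorphB [X in _ - X]rmorphM (rmorph_even_part (in_qpoly modulus)).
rewrite (rmorph_odd_part (in_qpoly modulus)) rmorphXn.
apply: f1_f3_quotient; first exact: modXX_nilp.
rewrite -!fps_mod_qpoch // -fps_modX -[RHS]fps_modM.
by apply: fps_mod_div; rewrite fps_exp_qpoch4_0 unitr1.
Qed.

End Truncation.

Theorem theorem4p5 (n : nat) :
  [/\ 0 < a_1_3_m4 (4 * n)%N,
      a_1_3_m4 (4 * n + 2)%N < 0
    & a_1_3_m4 (2 * n + 1)%N < 0].
Proof.
pose M := (4 * n + 2)%N.
(* Exhibits [E] and [O] at ['X ^+ 2] as polynomials composed with ['X^2], so that only even degrees
   occur. *)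
have X2 : 'X ^+ 2 = 'X \Po 'X^2 :> {poly int} by rewrite comp_polyX.
have evenE k : (2 * k <= M)%N ->
    a_1_3_m4 (2 * k)%N = (-1) ^+ k * (even_part M.+1 (- 'X : {poly int}))`_k.
  move=> le_kM; rewrite (@coef_a_1_3_m4 M) // coefB coefXM X2.
  rewrite -(rmorph_even_part (comp_poly 'X^2)) -(rmorph_odd_part (comp_poly 'X^2)).
  rewrite !coef_comp_poly_Xn // dvdn_mulr // mulKn // -coef_comp_polyNX.
  rewrite rmorph_even_part /= raddfN /= comp_polyX opprK.
  (* The odd part contributes nothing: [coefXM] gives 0 in degree 0, and otherwise the index 2k - 1
     is odd. *)
  case: k le_kM => [|k] _; rewrite ?subr0 //= (_ : (2 %| _)%N = false) ?subr0 //.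
  by lia.
have oddE k : (2 * k + 1 <= M)%N ->
    a_1_3_m4 (2 * k + 1)%N = - (odd_part M.+1 ('X : {poly int}))`_k.
  move=> le_kM; rewrite (@coef_a_1_3_m4 M) // coefB coefXM addn1 /= X2.
  rewrite -(rmorph_even_part (comp_poly 'X^2)) -(rmorph_odd_part (comp_poly 'X^2)).
  rewrite !coef_comp_poly_Xn // dvdn_mulr // mulKn //.
  by rewrite (_ : (2 %| _)%N = false) ?sub0r //; lia.
have ev_gt0 k : (k <= M)%N -> 0 < (even_part M.+1 (- 'X : {poly int}))`_k.
  by move=> le_kM; apply: even_part_gt0.
split.
- rewrite (_ : 4 * n = 2 * (2 * n))%N ?evenE ?exprM ?sqrrN ?expr1n ?mul1r; try lia.
  by apply: ev_gt0; lia.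
- rewrite (_ : 4 * n + 2 = 2 * (2 * n).+1)%N ?evenE ?exprS ?exprM; try lia.
  by rewrite sqrrN !expr1n mulr1 mulN1r oppr_lt0 ev_gt0; lia.
- rewrite oddE ?oppr_lt0; last by lia.
  by apply: odd_part_gt0; lia.
Qed.
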